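(* For any integer $n \geq 2$, $$|\mathcal{F}(n; 213, 321)| = |\mathcal{F}(n-1; 213, 321)| + n-2,$$ with initial condition $|\mathcal{F}(1; 213, 321)| = 1$. Consequently, $$|\mathcal{F}(n; 213, 321)| = \binom{n-1}{2} + 1.$$
   Context: For a positive integer $n$, $[n]=\{1,\dots,n\}$, and a permutation $\sigma$ of $[n]$ is written as the word $\sigma(1)\sigma(2)\cdots\sigma(n)$. A run of $\sigma$ is a maximal block of consecutive positions on which $\sigma$ is increasing, so $\sigma$ is uniquely the concatenation of its runs; the starting point of a run is its first entry. A flattened partition over $[n]$ is a permutation of $[n]$ whose runs, read from left to right, have increasing starting points. A permutation contains a pattern $\tau$ if it has a (not necessarily contiguous) subsequence order-isomorphic to $\tau$; otherwise it is $\tau$-avoiding. $\mathcal{F}(n;\tau_1,\tau_2)$ is the set of flattened partitions over $[n]$ avoiding both $\tau_1$ and $\tau_2$. *)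

(* Defs.v *)
From mathcomp Require Import all_boot all_fingroup.
Set Implicit Arguments.
Unset Strict Implicit.
Unset Printing Implicit Defensive.

(* 'S_n permutes {0, ..., n-1}; the word is shifted to have letters 1, ..., n. *)
Definition word_of (n : nat) (s : 'S_n) : seq nat :=
  [seq (s i).+1 | i <- enum 'I_n].

(* The maximal increasing blocks, from left to right: a letter is glued to the
   run following it exactly when it is smaller than the first entry of that
   run. *)
Fixpoint runs (w : seq nat) : seq (seq nat) :=
  if w is x :: w' then
    if runs w' is (y :: r) :: rs then
      if x < y then (x :: y :: r) :: rs else [:: x] :: (y :: r) :: rs
    else [:: [:: x]]
  else [::].

(* The default value of head is irrelevant: no run is empty. *)
Definition starting_points (w : seq nat) : seq nat := [seq head 0 r | r <- runs w].

Definition flattened (w : seq nat) : bool := sorted ltn (starting_points w).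

Definition order_isomorphic (u v : seq nat) : bool :=
  (size u == size v) &&
  [forall i : 'I_(size u), forall j : 'I_(size u),
     (nth 0 u i < nth 0 u j) == (nth 0 v i < nth 0 v j)].

(* The subsequences of w are its masks by boolean words of the same length. *)
Definition contains (tau w : seq nat) : bool :=
  [exists m : (size w).-tuple bool, order_isomorphic (mask m w) tau].

Definition avoids (tau w : seq nat) : bool := ~~ contains tau w.

Definition flattened_avoiding (n : nat) (tau1 tau2 : seq nat) : {set 'S_n} :=
  [set s : 'S_n | [&& flattened (word_of s),
                      avoids tau1 (word_of s) & avoids tau2 (word_of s)]].

(* Main.v *)
Require Import Defs.
From mathcomp Require Import all_boot all_fingroup.
From mathcomp Require Import zify.

(** The words counted here have a rigid shape: besides the identity word, they
    are exactly the words
        1 .. p | q+1 .. n | p+1 .. q        with 1 <= p < q < n,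
    obtained from the identity by exchanging the two adjacent intervals
    {p+1, .., q} and {q+1, .., n} ([fa_wordP]). Since p < q are two arbitrary
    elements of {1, .., n-1}, there are 'C(n-1, 2) of them, and the recurrence
    is Pascal's rule applied to this closed formula.

    The shape comes from looking at the first descent x > y, where x ends the
    first run and y starts the second one.  If the second run were followed by
    a third one starting with z, then its last entry t would satisfy t > z, so
    that x t z is a 321 when t < x, and x y t is a 213 when t > x
    ([sorted_after_descent]).  So there are at most two runs A and B.  When
    there are two, avoiding 213 means that an entry of A exceeding the first
    entry of B exceeds all of B.  Hence A splits as L ++ H with L < B < H, and
    L ++ B ++ H, being increasing, is 1 .. n ([exchange_of_two_runs]).
    Flattenedness says that the first entry of A is smaller than the first
    entry of B, that is, L is not empty; H is not empty because it contains x.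

    Conversely, in a concatenation of two increasing words, a 321 would need
    two descents while there is only one; and a 213 would have its 2 in the
    first word and its 1 and 3 in the second, which the gap between L and H
    excludes ([avoids321_cat], [avoids213_cat]). *)

Set Implicit Arguments.
Unset Strict Implicit.
Unset Printing Implicit Defensive.

(** * Increasing words *)

Lemma ltn_sorted_eq_perm (s t : seq nat) :
  sorted ltn s -> sorted ltn t -> perm_eq s t -> s = t.
Proof.
move=> ss st st_eq; apply: (irr_sorted_eq ltn_trans ltnn) => //.
exact: perm_mem.
Qed.

(** * Pattern containment by subsequences *)

Lemma order_isomorphicP (u v : seq nat) :
  reflect (size u = size v /\
           forall i j, i < size u -> j < size u ->
             (nth 0 u i < nth 0 u j) = (nth 0 v i < nth 0 v j))
          (order_isomorphic u v).
Proof.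
apply: (iffP andP) => [[/eqP sz /forallP H]|[sz H]]; split.
- exact: sz.
- by move=> i j lti ltj; have /forallP/(_ (Ordinal ltj))/eqP := H (Ordinal lti).
- exact/eqP.
- by apply/forallP => i; apply/forallP => j; apply/eqP/H.
Qed.

Lemma containsP (tau w : seq nat) :
  reflect (exists2 u, subseq u w & order_isomorphic u tau) (contains tau w).
Proof.
apply: (iffP existsP) => [[m iso]|[u /subseqP[m sz ->] iso]].
  by exists (mask m w) => //; apply: mask_subseq.
have szm : size m == size w by apply/eqP.
by exists (Tuple szm).
Qed.

Lemma contains213P (w : seq nat) :
  reflect (exists a b c, subseq [:: a; b; c] w /\ b < a < c)
          (contains [:: 2; 1; 3] w).
Proof.
apply: (iffP (containsP _ _)) => [[u uw /order_isomorphicP[]]|].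
  case: u uw => [|a [|b [|c [|//]]]] //= uw _ H.
  exists a, b, c; split=> //.
  by have /= := H 1 0 isT isT; have /= := H 0 2 isT isT => -> ->.
case=> a [b [c [uw /andP[ba ac]]]]; exists [:: a; b; c] => //.
apply/order_isomorphicP; split=> // -[|[|[|i]]] [|[|[|j]]] //= _ _; lia.
Qed.

Lemma contains321P (w : seq nat) :
  reflect (exists a b c, subseq [:: a; b; c] w /\ c < b < a)
          (contains [:: 3; 2; 1] w).
Proof.
apply: (iffP (containsP _ _)) => [[u uw /order_isomorphicP[]]|].
  case: u uw => [|a [|b [|c [|//]]]] //= uw _ H.
  exists a, b, c; split=> //.
  by have /= := H 2 1 isT isT; have /= := H 1 0 isT isT => -> ->.
case=> a [b [c [uw /andP[cb ba]]]]; exists [:: a; b; c] => //.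
apply/order_isomorphicP; split=> // -[|[|[|i]]] [|[|[|j]]] //= _ _; lia.
Qed.

Lemma subseq_cat_split (T : eqType) (u s t : seq T) :
  subseq u (s ++ t) ->
  exists u1 u2, [/\ u = u1 ++ u2, subseq u1 s & subseq u2 t].
Proof.
case/subseqP=> m; rewrite size_cat => szm ->.
exists (mask (take (size s) m) s), (mask (drop (size s) m) t).
rewrite !mask_subseq -mask_cat ?cat_take_drop // size_take szm.
by case: ltnP => //; lia.
Qed.

(** * Runs *)

Lemma runs_head x w : exists r rs, runs (x :: w) = (x :: r) :: rs.
Proof.
rewrite /=; case: (runs w) => [|[|y r] rs]; try by exists [::]; eexists.
by case: ifP => _; do 2 eexists.
Qed.

(** Peels off the first run: the disjunction says that the increasing prefix
    [x :: r] cannot be extended.  It is what [runs_cat] needs to recognise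
    [x :: r] as a run. *)
Lemma first_run x w : exists r v,
  [/\ w = r ++ v, path ltn x r & nilp v || (head 0 v <= last x r)].
Proof.
elim: w x => [|y w IH] x; first by exists [::], [::].
have [ltxy|leyx] := ltnP x y; last by exists [::], (y :: w).
have [r [v [-> pr hv]]] := IH y.
by exists (y :: r), v; rewrite /= ltxy.
Qed.

Lemma runs_cat x r v :
  path ltn x r -> nilp v || (head 0 v <= last x r) ->
  runs ((x :: r) ++ v) = (x :: r) :: runs v.
Proof.
elim: r x => [|y r IH] x /=.
  case: v => [|z v] //= _ lezx.
  have [r [rs /= ->]] := runs_head z v.
  by rewrite ltnNge lezx.
by case/andP=> ltxy pr hv; move: (IH y pr hv) => /= ->; rewrite ltxy.
Qed.

(** * Exchanging two adjacent intervals *)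

Definition exchange (n p q : nat) : seq nat :=
  iota 1 p ++ (iota q.+1 (n - q) ++ iota p.+1 (q - p)).

Definition fa_word (n : nat) (w : seq nat) : bool :=
  [&& perm_eq w (iota 1 n), flattened w,
      avoids [:: 2; 1; 3] w & avoids [:: 3; 2; 1] w].

Lemma iota_cut3 n p q : p <= q <= n ->
  iota 1 n = iota 1 p ++ (iota p.+1 (q - p) ++ iota q.+1 (n - q)).
Proof.
move=> /andP[lepq leqn].
have -> : iota 1 n = iota 1 (p + ((q - p) + (n - q))) by congr iota; lia.
rewrite !iotaD; congr (_ ++ (_ ++ iota _ _)); lia.
Qed.

Lemma perm_exchange n p q : p <= q <= n -> perm_eq (exchange n p q) (iota 1 n).
Proof.
by move=> pqn; rewrite (iota_cut3 pqn) /exchange perm_cat2l perm_catC.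
Qed.

Lemma sorted_iota_cat p q n : p <= q -> sorted ltn (iota 1 p ++ iota q.+1 n).
Proof.
move=> lepq; rewrite (sorted_pairwise ltn_trans) pairwise_cat.
rewrite -!(sorted_pairwise ltn_trans) !iota_ltn_sorted !andbT.
by apply/allrelP => x y; rewrite !mem_iota; lia.
Qed.

Lemma last_iota x m k : 0 < k -> last x (iota m k) = (m + k).-1.
Proof.
by case: k => // k _; rewrite -nth_last size_iota nth_iota // addnS.
Qed.

Lemma runs_sorted x r : path ltn x r -> runs (x :: r) = [:: x :: r].
Proof. by move=> pr; rewrite -[X in runs (_ :: X)]cats0 -cat_cons runs_cat. Qed.

Lemma starting_points_exchange n p q : 0 < p < q -> q < n ->
  starting_points (exchange n p q) = [:: 1; p.+1].
Proof.
case: p => // p /= ltpq ltqn.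
have pI := sorted_iota_cat (n - q) (ltnW ltpq).
rewrite /exchange catA /starting_points cat_cons runs_cat //; last first.
  rewrite last_cat last_iota ?subn_gt0 //; apply/orP; right.
  by case E: (q - p.+1) => [|k] /=; lia.
have pJ := iota_ltn_sorted p.+2 (q - p.+1).
by case E: (q - p.+1) pJ => [|k] pJ; [lia | rewrite [iota _ _]/= runs_sorted].
Qed.

Lemma last_exchange n p q : p < q -> last 0 (exchange n p q) = q.
Proof. by move=> ltpq; rewrite /exchange !last_cat last_iota; lia. Qed.

(** Pigeonhole: two of the three letters of a 321 would come from the same
    increasing word. *)
Lemma avoids321_cat (s t : seq nat) :
  sorted ltn s -> sorted ltn t -> avoids [:: 3; 2; 1] (s ++ t).
Proof.
move=> ss st; apply/negP => /contains321P[a [b [c [/subseq_cat_split]]]].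
case=> u1 [u2 [E /(subseq_sorted ltn_trans)/(_ ss) s1]].
move=> /(subseq_sorted ltn_trans)/(_ st) s2.
case: u1 E s1 => [|x [|y u1]] /= E; move: E s2.
- by move=> <- /= /andP[]; lia.
- by case=> _ <- /= /andP[]; lia.
by case=> <- <- _ _ /andP[]; lia.
Qed.

(** The descent from 2 to 1 has to straddle the two words, so that 1 and 3 both
    come from [t]; the hypothesis forbids a letter of [s] lying strictly
    between two letters of [t]. *)
Lemma avoids213_cat (s t : seq nat) :
  sorted ltn s -> sorted ltn t ->
  (forall a b c, a \in s -> b \in t -> c \in t -> b < a -> c <= a) ->
  avoids [:: 2; 1; 3] (s ++ t).
Proof.
move=> ss st gap; apply/negP => /contains213P[a [b [c [/subseq_cat_split]]]].
case=> u1 [u2 [E sub1 sub2]] /andP[ltba ltac].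
have s1 := subseq_sorted ltn_trans sub1 ss.
have s2 := subseq_sorted ltn_trans sub2 st.
case: u1 E sub1 s1 => [|x [|y u1]] /= E; move: E sub2 s2.
- by move=> <- _ /= /andP[]; lia.
- case=> <- <- /mem_subseq sub2 _ /mem_subseq sub1 _.
  have := gap a b c (sub1 _ (mem_head _ _)) (sub2 _ (mem_head _ _)).
  by rewrite sub2 ?inE ?eqxx ?orbT // => /(_ isT ltba); lia.
by case=> <- <- _ _ _ _ /andP[]; lia.
Qed.

Lemma fa_word_exchange n p q :
  0 < p < q -> q < n -> fa_word n (exchange n p q).
Proof.
move=> ltpq ltqn; have /andP[p_gt0 lepq] : 0 < p <= q by lia.
apply/and4P; split; first by apply: perm_exchange; lia.
- by rewrite /flattened starting_points_exchange //= andbT ltnS.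
- rewrite /exchange catA; apply: avoids213_cat => //.
  + exact: sorted_iota_cat.
  + exact: iota_ltn_sorted.
  by move=> a b c; rewrite mem_cat !mem_iota; lia.
rewrite /exchange catA; apply: avoids321_cat; last exact: iota_ltn_sorted.
exact: sorted_iota_cat.
Qed.

Lemma fa_word_iota n : fa_word n (iota 1 n).
Proof.
apply/and4P; split=> //.
- case: n => [|n] //; rewrite /flattened /starting_points runs_sorted //.
  exact: (iota_ltn_sorted 1 n.+1).
- rewrite -[iota 1 n]cats0; apply: avoids213_cat => //.
  exact: iota_ltn_sorted.
- rewrite -[iota 1 n]cats0; apply: avoids321_cat => //.
  exact: iota_ltn_sorted.
Qed.

(** * The shape of the avoiders *)

(** If a third run existed, the descent from the last letter of the second run
    to the first letter of the third would create one of the patterns together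
    with the top [last x r] of the first descent: a 321 if the second run ends
    below [last x r], and otherwise a 213 made of [last x r], [y] and the last
    letter of the second run. *)
Lemma sorted_after_descent x r y v :
  path ltn x r -> y < last x r -> uniq ((x :: r) ++ y :: v) ->
  avoids [:: 2; 1; 3] ((x :: r) ++ y :: v) ->
  avoids [:: 3; 2; 1] ((x :: r) ++ y :: v) -> sorted ltn (y :: v).
Proof.
move=> pr lt_y_last Hu /negP n213 /negP n321.
have [s [t [Ev ps]]] := first_run y v.
case: t Ev => [|z t] Ev /= hz; first by rewrite Ev cats0.
have sub_tail u : subseq u (y :: v) ->
    subseq (last x r :: u) ((x :: r) ++ y :: v).
  move=> su; rewrite -[_ :: u]cat1s.
  by apply: cat_subseq => //; rewrite sub1seq mem_last.
have last_neq : last y s != last x r.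
  move: Hu; rewrite cat_uniq => /and3P[_ /hasPn H _].
  apply/eqP=> E; have := H (last y s).
  rewrite E mem_last /= => /(_ _)/negP; apply => //.
  by rewrite -E Ev -cat_cons mem_cat mem_last.
have z_neq : z != last y s.
  move: Hu; rewrite cat_uniq => /and3P[_ _].
  rewrite Ev -cat_cons cat_uniq => /and3P[_ /hasPn/(_ z (mem_head _ _)) H _].
  by apply: contraNneq H => ->; rewrite /= mem_last.
have [lt_last|] := ltnP (last y s) (last x r).
  case: n321; apply/contains321P.
  exists (last x r), (last y s), z; split.
  2: by rewrite lt_last andbT ltn_neqAle z_neq.
  apply: sub_tail; rewrite Ev -cat_cons -[[:: _; _]]cat1s.
  by apply: cat_subseq; rewrite sub1seq ?mem_last ?mem_head.
move=> le_last; case: n213; apply/contains213P.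
exists (last x r), y, (last y s); split.
  2: by rewrite lt_y_last ltn_neqAle eq_sym last_neq.
apply: sub_tail; rewrite /= eqxx sub1seq Ev mem_cat.
have := mem_last y s; rewrite inE => /orP[/eqP E|-> //].
by rewrite E leqNgt lt_y_last in le_last.
Qed.

(** The letters [h > b] of the first run are larger than every letter [c] of
    the second one, for otherwise [h], [b], [c] would be a 213. The second run
    thus fits between the letters of the first run smaller than [b] and those
    larger than [b]; reinserting it there sorts the word. *)
Lemma exchange_of_two_runs n a A b B :
  path ltn a A -> path ltn b B -> a < b < last a A ->
  perm_eq ((a :: A) ++ b :: B) (iota 1 n) ->
  avoids [:: 2; 1; 3] ((a :: A) ++ b :: B) ->
  exists p q, [/\ 0 < p < q, q < n & (a :: A) ++ b :: B = exchange n p q].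
Proof.
move=> pA pB /andP[ltab ltba] pAB /negP n213.
have sA : sorted ltn (a :: A) by [].
have sB : sorted ltn (b :: B) by [].
set L := [seq x <- a :: A | x < b].
set H := [seq x <- a :: A | predC (gtn b) x].
have sL : sorted ltn L by exact: (sorted_filter ltn_trans).
have sH : sorted ltn H by exact: (sorted_filter ltn_trans).
have Hu : uniq ((a :: A) ++ b :: B) by rewrite (perm_uniq pAB) iota_uniq.
have bNA : b \notin a :: A.
  by move: Hu; rewrite cat_uniq => /and3P[_ /hasPn/(_ b (mem_head _ _))].
have H_above c h : c \in b :: B -> h \in H -> c < h.
  rewrite mem_filter /= -leqNgt => cB /andP[lebh hA].
  have lt_bh : b < h.
    by rewrite ltn_neqAle lebh andbT; apply: contraNneq bNA => ->.
  move: cB; rewrite inE => /predU1P[-> //|cB].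
  have hNB : h != c.
    apply: contraTneq hA => ->; move: Hu; rewrite cat_uniq.
    by case/and3P=> _ /hasPn/(_ c) /=; rewrite inE cB orbT => /(_ isT).
  rewrite ltnNge; apply/negP => le_hc; case: n213; apply/contains213P.
  exists h, b, c; split; last by rewrite lt_bh; lia.
  rewrite -[[:: h; b; c]]cat1s; apply: cat_subseq; first by rewrite sub1seq.
  by rewrite /= eqxx sub1seq.
have B_ge c : c \in b :: B -> b <= c.
  rewrite inE => /predU1P[-> //|cB].
  exact/ltnW/(allP (order_path_min ltn_trans pB)).
have L_below x : x \in L -> x < b by rewrite mem_filter => /andP[].
have EA : a :: A = L ++ H.
  apply: ltn_sorted_eq_perm => //; last by rewrite perm_sym perm_filterC.
  rewrite (sorted_pairwise ltn_trans) pairwise_cat.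
  rewrite -!(sorted_pairwise ltn_trans) sL sH !andbT.
  by apply/allrelP => x y /L_below ltxb /(H_above b y (mem_head _ _)); lia.
have sLBH : sorted ltn (L ++ ((b :: B) ++ H)).
  rewrite (sorted_pairwise ltn_trans) !pairwise_cat.
  rewrite -!(sorted_pairwise ltn_trans) sL sH sB !andbT; apply/andP; split.
    apply/allrelP => x y /L_below ltxb; rewrite mem_cat => /orP[/B_ge|].
      by lia.
    by move/(H_above b y (mem_head _ _)); lia.
  by apply/allrelP => x y; apply: H_above.
have E : L ++ ((b :: B) ++ H) = iota 1 n.
  apply: ltn_sorted_eq_perm => //; first exact: iota_ltn_sorted.
  by rewrite -(permPr pAB) EA -catA perm_cat2l perm_catC.
have szn : n = size L + (size (b :: B) + size H).
  by rewrite -(size_iota 1 n) -E !size_cat.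
have Lpos : 0 < size L.
  rewrite -has_predT; apply/hasP; exists a => //.
  by rewrite mem_filter ltab mem_head.
have Hpos : 0 < size H.
  rewrite -has_predT; apply/hasP; exists (last a A) => //.
  by rewrite mem_filter mem_last /= -leqNgt ltnW.
(* In the sorted word L ++ B ++ H, the letters of L are 1 .. p and those of B
   are p+1 .. q, so p and q are read off the lengths. *)
exists (size L), (size L + size (b :: B)).
split; first by rewrite Lpos -[X in X < _]addn0 ltn_add2l.
  by rewrite szn addnA -[X in X < _]addn0 ltn_add2l.
move: E; rewrite (@iota_cut3 n (size L) (size L + size (b :: B))); last by lia.
rewrite EA /exchange.
set q := _ + size (b :: B); move/eqP.
rewrite eqseq_cat ?size_iota // => /andP[/eqP<-].
rewrite eqseq_cat ?size_iota; last by rewrite /q addKn.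
by case/andP=> /eqP<- /eqP<-; rewrite catA.
Qed.

Lemma fa_wordP n w :
  reflect (w = iota 1 n \/
           exists p q, [/\ 0 < p < q, q < n & w = exchange n p q])
          (fa_word n w).
Proof.
apply: (iffP idP); last first.
  case=> [->|[p [q [ltpq ltqn ->]]]]; first exact: fa_word_iota.
  exact: fa_word_exchange.
case/and4P=> pw fw n213 n321.
have uw : uniq w by rewrite (perm_uniq pw) iota_uniq.
case: w => [|x w] in pw fw n213 n321 uw *.
  by left; apply: ltn_sorted_eq_perm => //; exact: iota_ltn_sorted.
have [r [v [Ew pr hv]]] := first_run x w.
rewrite {}Ew -cat_cons in pw fw n213 n321 uw *.
case: v => [|y v] in pw fw n213 n321 uw hv *.
  left; rewrite cats0 in pw *.
  by apply: ltn_sorted_eq_perm => //; exact: iota_ltn_sorted.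
right; rewrite /= in hv.
have lt_y_last : y < last x r.
  rewrite ltn_neqAle hv andbT; apply: contraTneq uw => ->.
  by rewrite cat_uniq /= mem_last andbF.
have sv : sorted ltn (y :: v) by exact: (sorted_after_descent pr).
have ltxy : x < y.
  move: fw; rewrite /flattened /starting_points runs_cat //.
  by rewrite runs_sorted //= andbT.
by apply: exchange_of_two_runs; rewrite ?ltxy.
Qed.

(** * Counting *)

Lemma word_of_inj n : injective (@word_of n).
Proof.
move=> s t /eq_in_map E; apply/permP => i; apply/val_inj.
by have [] := E i (mem_enum _ _).
Qed.

Lemma word_ofP n w :
  reflect (exists s : 'S_n, w = word_of s) (perm_eq w (iota 1 n)).
Proof.
have Et : iota 1 n = [tuple i.+1 | i < n].
  by rewrite /= -[1]addn0 iotaDl -val_enum_ord -map_comp.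
rewrite Et; apply: (iffP tuple_permP) => -[s ->]; exists s;
  by apply: eq_map => i; rewrite tnth_mktuple.
Qed.

(** The pairs p < q of {1, .., n-1} are listed as (i+1, j+1) with i < j < n-1,
    so that the length is the triangular sum of the j < n-1. *)
Definition fa_words (n : nat) : seq (seq nat) :=
  iota 1 n :: [seq exchange n i.+1 j.+1 | j <- iota 0 n.-1, i <- iota 0 j].

Lemma mem_fa_words n w : (w \in fa_words n) = fa_word n w.
Proof.
rewrite inE; apply/idP/fa_wordP => [/predU1P[->|/allpairsPdep]|]; first by left.
  case=> j [i [lt_j lt_i ->]]; right; exists i.+1, j.+1.
  by move: lt_j lt_i; rewrite !mem_iota; split=> //; lia.
case=> [->|[[|p] [[|q] [//= ltpq ltqn ->]]]]; first by rewrite eqxx.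
apply/orP; right; apply/allpairsPdep; exists q, p.
by rewrite !mem_iota; split=> //; lia.
Qed.

(** An exchanged word determines its parameters: p+1 is its second starting
    point and q its last letter. The last letter also tells it apart from the
    identity word, which ends with n > q. *)
Lemma uniq_fa_words n : uniq (fa_words n).
Proof.
rewrite /fa_words /=; apply/andP; split.
  apply/allpairsPdep => -[j [i []]]; rewrite !mem_iota => lt_j lt_i.
  move/(congr1 (last 0)); rewrite last_iota ?last_exchange; lia.
apply: allpairs_uniq_dep => [|j _|]; try exact: iota_uniq.
move=> _ _ /allpairsPdep[j [i [+ + ->]]] /allpairsPdep[l [k [+ + ->]]] /=.
rewrite !mem_iota => lt_j lt_i lt_l lt_k E.
have /= := congr1 starting_points E.
rewrite !starting_points_exchange; try lia.
case=> -> ; have := congr1 (last 0) E.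
by rewrite !last_exchange; [case=> -> | lia | lia].
Qed.

Lemma size_fa_words n : size (fa_words n) = 'C(n.-1, 2) + 1.
Proof.
rewrite /= size_allpairs_dep addn1; congr _.+1.
rewrite (eq_map (fun j => size_iota 0 j)) map_id sumnE.
by rewrite -[n.-1 in LHS]subn0 -/(index_iota 0 n.-1) bin2_sum.
Qed.

Lemma card_flattened_avoiding n :
  #|flattened_avoiding n [:: 2; 1; 3] [:: 3; 2; 1]| = 'C(n.-1, 2) + 1.
Proof.
rewrite -size_fa_words cardE -(size_map (@word_of n)).
apply/perm_size/uniq_perm; [|exact: uniq_fa_words|].
  by rewrite (map_inj_uniq (@word_of_inj n)) enum_uniq.
move=> w; rewrite mem_fa_words; apply/mapP/andP => [[s]|[/word_ofP[s ->] fs]].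
  rewrite mem_enum inE => fs ->; split=> //.
  by apply/word_ofP; exists s.
by exists s; rewrite // mem_enum inE.
Qed.

Theorem proposition3p11 :
  (forall n : nat, 2 <= n ->
     #|flattened_avoiding n [:: 2; 1; 3] [:: 3; 2; 1]|
     = #|flattened_avoiding (n - 1) [:: 2; 1; 3] [:: 3; 2; 1]| + (n - 2))
  /\ #|flattened_avoiding 1 [:: 2; 1; 3] [:: 3; 2; 1]| = 1
  /\ (forall n : nat, 1 <= n ->
        #|flattened_avoiding n [:: 2; 1; 3] [:: 3; 2; 1]| = 'C(n - 1, 2) + 1).
Proof.
split; [|split]; first 1 last.
- by rewrite card_flattened_avoiding.
- by move=> n _; rewrite card_flattened_avoiding subn1.
move=> [|[|n]] // _; rewrite !card_flattened_avoiding !subSS !subn0 /=.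
by rewrite binS bin1; lia.
Qed.
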